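(* Let $0<q<p<1$ and $k\in\mathbb{N}\setminus\{1\}$ be constants, and let \[ \tilde{\xi}=\min\left\{\ln\left(\frac{p e +(k-1)q}{p+(k-1)q}\right),\ \frac{p}{p+(k-1)q}\right\}. \] Then for every $0\leq \rho <\tilde{\xi}$, if $G\in\mathcal{G}(n,k,p,q)$, the probability that the colouring of $G$ induced by its communities is $\rho$-happy tends to $1$ as $n\to\infty$.
   Context: All graphs are simple, finite and unweighted. For a graph $G$ and $0\leq\rho\leq 1$, given a vertex colouring $c:V(G)\to\{1,\dots,k\}$, a vertex $v$ is called $\rho$-happy if at least $\rho\cdot\deg(v)$ of its neighbours have colour $c(v)$; the colouring $c$ is $\rho$-happy if every vertex of $G$ is $\rho$-happy. The stochastic block model $\mathcal{G}(n,k,p,q)$ is the random graph on $n$ vertices whose vertex set is partitioned into $k$ communities $C_1,\dots,C_k$ of nearly equal size $\approx n/k$ (sizes differ by at most one); each pair of distinct vertices is joined by an edge independently with probability $p$ if both lie in the same community and with probability $q$ otherwise. The colouring induced by the communities assigns colour $i$ to every vertex of $C_i$. *)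

(* Defs.v *)
From HB Require Import structures.
From mathcomp Require Import all_boot all_order all_algebra.
From mathcomp Require Import all_classical all_reals all_analysis.

Set Implicit Arguments.
Unset Strict Implicit.
Unset Printing Implicit Defensive.

Import Order.TTheory GRing.Theory Num.Theory.
Import numFieldNormedType.Exports.

Local Open Scope ring_scope.

Definition vpairs (T : finType) : {set {set T}} := [set e : {set T} | #|e| == 2].

(** A simple graph on [T] is its set of edges, an edge being an unordered pair
    of distinct vertices. *)
Record sgraph (T : finType) := SGraph {
  edges :> {set {set T}};
  edges_vpairs : edges \subset vpairs T
}.
Arguments edges {T}.
HB.instance Definition _ (T : finType) := [isSub for @edges T].
HB.instance Definition _ (T : finType) := [Finite of sgraph T by <:].

Section Happiness.
Context {T : finType} {k : nat} {R : realType}.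
Implicit Types (G : sgraph T) (c : T -> 'I_k) (rho : R) (v : T).

Definition neighbours G v : {set T} := [set u | [set u; v] \in edges G].

Definition degree G v : nat := #|neighbours G v|.

Definition happy_vertex G rho c v : bool :=
  rho * (degree G v)%:R <= #|[set u in neighbours G v | c u == c v]|%:R.

Definition happy G rho c : bool := [forall v, happy_vertex G rho c v].

End Happiness.

Section StochasticBlockModel.
Context {T : finType} {k : nat} {R : realType}.
Implicit Types (c : T -> 'I_k) (p q : R).

(** The partition into communities is encoded by the map [c] sending a vertex to
    the index of its community; [c] is thus also the colouring induced by the
    communities. A community may be empty (when [#|T| < k]). *)
Definition community c (i : 'I_k) : {set T} := [set v | c v == i].

Definition balanced c : Prop :=
  forall i j : 'I_k, (#|community c i| <= #|community c j| + 1)%N.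

Definition edge_prob c p q (e : {set T}) : R :=
  if [exists i, e \subset community c i] then p else q.

(** Probability mass of the graph [G] when the pairs of distinct vertices are
    joined independently. *)
Definition sbm_mass c p q (G : sgraph T) : R :=
  \prod_(e in vpairs T)
    (if e \in edges G then edge_prob c p q e else 1 - edge_prob c p q e).

Definition sbm_prob c p q (E : pred (sgraph T)) : R :=
  \sum_(G | E G) sbm_mass c p q G.

Lemma sbm_mass_ge0 c p q G :
  0 <= p <= 1 -> 0 <= q <= 1 -> 0 <= sbm_mass c p q G.
Proof.
move=> /andP[p0 p1] /andP[q0 q1]; apply: prodr_ge0 => e _.
by rewrite /edge_prob; case: ifP => _; case: ifP => _; rewrite ?subr_ge0.
Qed.

Lemma sbm_probT c p q : sbm_prob c p q predT = 1.
Proof.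
pose f := edge_prob c p q.
pose F e := if e \in vpairs T then f e else 0.
pose H e := if e \in vpairs T then 1 - f e else 1.
have : \prod_(e : {set T}) (F e + H e) = 1.
  apply: big1 => e _; rewrite /F /H; case: ifP => _; last by rewrite add0r.
  by rewrite addrC subrK.
rewrite bigA_distr (bigID (fun E : {set {set T}} => E \subset vpairs T)) /=.
rewrite [X in _ + X]big1 ?addr0 => [<-|E /subsetPn[e eE enp]]; last first.
  by rewrite (bigD1 e) //= eE /F (negbTE enp) mul0r.
rewrite /sbm_prob (reindex_omap (@edges T) insub) /=; last first.
  by move=> E EP; rewrite insubT.
apply: eq_big => [G|G _].
  by rewrite (edges_vpairs G) valK eqxx.
rewrite /sbm_mass [RHS](bigID (mem (vpairs T))) /= [X in _ * X]big1 ?mulr1.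
  by apply: eq_bigr => e ev; rewrite /F /H ev.
move=> e env; rewrite /F /H (negbTE env); case: ifP => // eG.
by rewrite (fintype.subsetP (edges_vpairs G) _ eG) in env.
Qed.

End StochasticBlockModel.

Definition xi_tilde {R : realType} (k : nat) (p q : R) : R :=
  Num.min (ln ((p * expR 1 + (k%:R - 1) * q) / (p + (k%:R - 1) * q)))
          (p / (p + (k%:R - 1) * q)).

(* Main.v *)
(** Let w(u) be 1 - rho if u lies in the community of v and -rho otherwise, and
    let Z be the sum of w over the neighbours of v: then v is rho-happy iff
    Z >= 0. Since rho < p / (p + (k - 1) q), the second term of the minimum in
    xi_tilde, Z has mean at least delta n - O(1) for the constant
    delta = (p (1 - rho) - (k - 1) q rho) / k > 0. The summands being
    independent, Markov's inequality for exp(- t Z), with t = delta / 4, bounds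
    the probability that v is unhappy by exp(O(1) - delta^2 n / 8), and a union
    bound over the n vertices concludes. *)
Require Import Defs.
From HB Require Import structures.
From mathcomp Require Import all_boot all_order all_algebra.
From mathcomp Require Import all_classical all_reals all_analysis.
From mathcomp Require Import ring lra zify.
Import Order.TTheory GRing.Theory Num.Theory.
Import numFieldNormedType.Exports.
Local Open Scope ring_scope.

(** Distributivity: expanding the product chooses, for each pair, presence or absence, and such
    choices are exactly the graphs. This is the form in which independence of the edges is used. *)
Lemma sum_sgraph_prod {T : finType} {R : comNzRingType}
    (h : {set T} -> bool -> R) :
  \sum_(G : sgraph T) \prod_(e in vpairs T) h e (e \in edges G) =
  \prod_(e in vpairs T) (h e true + h e false).
Proof.
(* The values 0 and 1 off [vpairs T] kill every edge set that contains a non-pair, so the expansion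
   can range over all sets [e]. *)
pose F e := if e \in vpairs T then h e true else 0.
pose H e := if e \in vpairs T then h e false else 1.
have -> : \prod_(e in vpairs T) (h e true + h e false) = \prod_e (F e + H e).
  rewrite big_mkcond; apply: eq_bigr => e _; rewrite /F /H.
  by case: ifP => // _; rewrite add0r.
rewrite bigA_distr (bigID (fun E : {set {set T}} => E \subset vpairs T)) /=.
rewrite [X in _ = _ + X]big1 ?addr0 => [|E /subsetPn[e eE enp]]; last first.
  by rewrite (bigD1 e) //= eE /F (negbTE enp) mul0r.
rewrite [RHS](reindex_omap (@edges T) insub) /=; last first.
  by move=> E EP; rewrite insubT.
apply: eq_big => [G|G _]; first by rewrite (edges_vpairs G) valK eqxx.
rewrite big_mkcond; apply: eq_bigr => e _; rewrite /F /H.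
case: ifP => ev; first by case: (e \in edges G).
by case: ifP => // eG; rewrite (fintype.subsetP (edges_vpairs G) _ eG) in ev.
Qed.

Lemma prod_incident_pairs {T : finType} {R : comNzRingType} (v : T)
    (F : {set T} -> R) :
  \prod_(e in vpairs T | v \in e) F e = \prod_(u | u != v) F [set u; v].
Proof.
have inj : {in [set~ v] &, injective (fun u => [set u; v])}.
  move=> x y; rewrite !inE => xv yv /setP/(_ x).
  by rewrite !inE eqxx (negbTE xv) !orbF => /esym/eqP.
transitivity (\prod_(u in [set~ v]) F [set u; v]); last first.
  by apply: eq_bigl => u; rewrite !inE.
rewrite -(big_imset _ inj); apply: eq_bigl => e; rewrite !inE.
apply/andP/imsetP => [[/cards2P[x [y [xy ->]]]]|[u]].
  rewrite !inE => /orP[]/eqP->; last by exists x; rewrite ?inE.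
  by exists y; rewrite ?inE 1?eq_sym // finset.setUC.
by rewrite !inE => uv ->; rewrite cards2 uv !inE eqxx orbT.
Qed.

(** From [1 - y <= expR (- y)] one gets [expR y * (1 - y) <= 1], while [(1 - y) * (1 + y + 2 * y ^+
    2) = 1 + y ^+ 2 * (1 - 2 * y)] is at least 1. *)
Lemma expR_le_quadratic {R : realType} (y : R) :
  y <= 2^-1 -> expR y <= 1 + y + 2 * y ^+ 2.
Proof.
move=> y2; have y1 : 0 < 1 - y by lra.
rewrite -(ler_pM2r y1); apply: (@le_trans _ _ 1).
  rewrite -[leRHS](expRxMexpNx_1 y).
  by rewrite ler_wpM2l ?expR_ge0 // expR_ge1Dx.
by rewrite -subr_ge0; have := sqr_ge0 y; nra.
Qed.

(** Supplies the lower bound |T| / k - 1 on the size of each community. *)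
Lemma card_le_balanced {T : finType} {k : nat} (c : T -> 'I_k) (i : 'I_k) :
  balanced c -> (#|T| <= k * (#|community c i|).+1)%N.
Proof.
move=> bal; rewrite -(sum1_card T) (partition_big c predT) //=.
have -> : (k * (#|community c i|).+1 = \sum_(j < k) (#|community c i|).+1)%N.
  by rewrite sum_nat_const card_ord.
apply: leq_sum => j _; rewrite -[leqRHS]addn1; apply: leq_trans (bal j i).
by rewrite -sum1_card; apply/eq_leq/eq_bigl => v; rewrite inE.
Qed.

Section Chernoff.
Context {T : finType} {k : nat} {R : realType}.
Variables (c : T -> 'I_k) (p q rho : R).
Hypotheses (p01 : 0 <= p <= 1) (q01 : 0 <= q <= 1) (rho01 : 0 <= rho <= 1).

Let P u v := if c u == c v then p else q.
Let w u v : R := (c u == c v)%:R - rho.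

Lemma same_communityE u v :
  [exists i, [set u; v] \subset community c i] = (c u == c v).
Proof.
apply/existsP/eqP => [[i]|cuv].
  by rewrite finset.subUset !finset.sub1set !inE => /andP[/eqP-> /eqP->].
by exists (c v); rewrite finset.subUset !finset.sub1set !inE cuv eqxx.
Qed.

Lemma edge_prob_pair u v : edge_prob c p q [set u; v] = P u v.
Proof. by rewrite /edge_prob same_communityE. Qed.

Lemma happy_vertexE (G : sgraph T) v :
  happy_vertex G rho c v = (0 <= \sum_(u in neighbours G v) w u v).
Proof.
rewrite /happy_vertex sumrB sumr_const subr_ge0 mulr_natr; congr (_ <= _).
rewrite -sum1_card natr_sum [RHS]big_mkcond /= [LHS]big_mkcond /=.
apply: eq_bigr => u _; rewrite !inE.
by case: (_ \in edges G) => //=; case: (c u == c v).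
Qed.

Lemma neighbours_prod (G : sgraph T) v (F : T -> R) :
  \prod_(u in neighbours G v) F u =
  \prod_(u | u != v) (if [set u; v] \in edges G then F u else 1).
Proof.
rewrite big_mkcond [RHS]big_mkcond; apply: eq_bigr => u _; rewrite inE.
have [->|//] := eqVneq u v.
case: ifP => // /(fintype.subsetP (edges_vpairs G)).
by rewrite inE finset.setUid cards1.
Qed.

Lemma unhappy_vertex_mgf (t : R) v : 0 <= t ->
  sbm_prob c p q [pred G | ~~ happy_vertex G rho c v] <=
  \prod_(u | u != v) (1 - P u v + P u v * expR (- t * w u v)).
Proof.
move=> t0.
(* The weight is a function of the pair [e], not of the neighbour, so that it fits the product over
   pairs in [sum_sgraph_prod]. *)
pose x (e : {set T}) := expR (- t * ([exists i, e \subset community c i]%:R - rho)).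
have xE u : x [set u; v] = expR (- t * w u v).
  by rewrite /x same_communityE.
pose h e (b : bool) :=
  (if b then edge_prob c p q e else 1 - edge_prob c p q e) *
  (if (v \in e) && b then x e else 1).
apply: (@le_trans _ _ (\sum_(G : sgraph T) \prod_(e in vpairs T) h e (e \in edges G))).
  rewrite /sbm_prob big_mkcond; apply: ler_sum => G _.
  rewrite big_split /= -/(sbm_mass c p q G).
  have m0 := sbm_mass_ge0 c G p01 q01.
  have -> : \prod_(e in vpairs T) (if (v \in e) && (e \in edges G) then x e else 1)
     = expR (- t * \sum_(u in neighbours G v) w u v).
    rewrite mulr_sumr expR_sum neighbours_prod.
    under [RHS]eq_bigr do rewrite -xE.
    rewrite -(prod_incident_pairs v (fun e => if e \in edges G then x e else 1)).
    rewrite [LHS]big_mkcond [RHS]big_mkcond; apply: eq_bigr => e _.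
    by case: (e \in vpairs T) => //=; case: (v \in e).
  case: ifPn => [|_]; last by rewrite mulr_ge0 // expR_ge0.
  (* Markov: an unhappy [v] has Z < 0, hence exp(- t Z) >= 1. *)
  rewrite /= happy_vertexE -ltNge => Z0; rewrite ler_peMr //.
  by rewrite -expR0 ler_expR; nra.
(* A pair avoiding [v] contributes [edge_prob + (1 - edge_prob) = 1]. *)
rewrite sum_sgraph_prod (bigID (fun e : {set T} => v \in e)) /= [X in _ * X]big1 ?mulr1.
  rewrite prod_incident_pairs le_eqVlt; apply/orP; left; apply/eqP/eq_bigr => u uv.
  by rewrite /h /= !inE eqxx orbT /= xE edge_prob_pair; ring.
by move=> e /andP[_ /negbTE ve]; rewrite /h ve /=; ring.
Qed.

(** Since |w| <= 1 and t <= 1/2, the quadratic bound applies to - t w; with 0 <= P <= 1 each factor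
    is at most 1 - t P w + 2 t^2, and 1 + x <= exp(x) finishes. *)
Lemma mgf_le (t : R) v : 0 <= t <= 2^-1 ->
  \prod_(u | u != v) (1 - P u v + P u v * expR (- t * w u v)) <=
  expR (\sum_(u | u != v) (2 * t ^+ 2 - t * (P u v * w u v))).
Proof.
move=> /andP[t0 t1]; rewrite expR_sum; apply: ler_prod => u _.
have P01 : 0 <= P u v <= 1 by rewrite /P; case: ifP.
move: P01 => /andP[P0 P1].
have w1 : -1 <= w u v <= 1.
  by move: rho01 => /andP[? ?]; rewrite /w; case: eqP => _ /=; apply/andP; split; lra.
move: w1 => /andP[wN w1].
have twle : - t * w u v <= 2^-1 by nra.
rewrite addr_ge0 ?subr_ge0 ?mulr_ge0 ?expR_ge0 //=.
apply: le_trans (expR_ge1Dx _).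
have := ler_wpM2l P0 (expR_le_quadratic _ twle).
have w2 : w u v ^+ 2 <= 1 by nra.
have t2 := sqr_ge0 t.
have : t ^+ 2 * w u v ^+ 2 * P u v <= t ^+ 2.
  rewrite -mulrA ler_piMr //; have := sqr_ge0 (w u v); nra.
rewrite exprMn sqrrN; lra.
Qed.

Lemma sum_drift v :
  \sum_u P u v * w u v =
  #|community c (c v)|%:R * (p * (1 - rho) + q * rho) - #|T|%:R * (q * rho).
Proof.
rewrite (eq_bigr (fun u => (c u == c v)%:R * (p * (1 - rho) + q * rho) - q * rho)).
  rewrite sumrB sumr_const -mulr_suml [X in _ = _ - X]mulr_natl; congr (_ * _ - _).
  rewrite -sum1_card natr_sum [RHS]big_mkcond.
  by apply: eq_bigr => u _; rewrite inE; case: eqP.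
by move=> u _; rewrite /P /w; case: eqP => _ /=; ring.
Qed.

Let delta : R := (p * (1 - rho) - (k%:R - 1) * q * rho) / k%:R.

Lemma unhappy_vertex_prob v : balanced c -> 0 < delta -> (1 < k)%N ->
  sbm_prob c p q [pred G | ~~ happy_vertex G rho c v] <=
  expR (delta - delta ^+ 2 / 8 * #|T|%:R).
Proof.
move=> bal d0 k1.
have k2 : 2 <= k%:R :> R by rewrite ler_nat.
have k0 : 0 < k%:R :> R by lra.
move: p01 q01 rho01 => /andP[p0 p1] /andP[q0 q1] /andP[r0 r1].
have prho : 0 <= p * (1 - rho) <= 1 by apply/andP; split; nra.
have qrho : 0 <= q * rho by nra.
have pqrho : p * (1 - rho) + q * rho <= 1 by nra.
have dk : delta * k%:R = p * (1 - rho) - (k%:R - 1) * q * rho.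
  by rewrite /delta divfK // gt_eqF.
have d1 : delta <= 1 by nra.
(* The leading part (2 t^2 - t delta) n of the exponent is minimal at t = delta / 4, with value -
   delta^2 n / 8. *)
apply: le_trans (unhappy_vertex_mgf (delta / 4) v _) _; first lra.
apply: le_trans (mgf_le (delta / 4) v _) _; first by apply/andP; split; lra.
rewrite ler_expR sumrB -[X in _ - X]mulr_sumr.
(* [sum_drift] counts [v] as its own neighbour; removing it costs p (1 - rho) <= 1. *)
have -> : \sum_(u | u != v) P u v * w u v =
    \sum_u P u v * w u v - p * (1 - rho).
  by rewrite [in RHS](bigD1 v) //= {2}/P {2}/w eqxx /=; ring.
rewrite sum_drift.
have card_le : \sum_(u | u != v) 2 * (delta / 4) ^+ 2 <= #|T|%:R * (2 * (delta / 4) ^+ 2).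
  rewrite sumr_const [leRHS]mulr_natl ler_wpMn2l ?max_card //.
  by rewrite mulr_ge0 ?sqr_ge0.
have C_ge : #|T|%:R <= k%:R * (#|community c (c v)|%:R + 1) :> R.
  by rewrite natr1 -natrM ler_nat; exact: card_le_balanced.
set C : R := #|community c (c v)|%:R in C_ge *.
set n : R := #|T|%:R in C_ge card_le *.
set s := p * (1 - rho) + q * rho in pqrho *.
have s0 : 0 <= s by rewrite /s; lra.
have sk : s = k%:R * (delta + q * rho) by rewrite mulrDr [_ * delta]mulrC dk /s; ring.
(* A community of size exactly n / k would give n delta, by [sk]; a deficit of at most one vertex
   costs at most s <= 1. *)
have drift : n * delta - 1 <= C * s - n * (q * rho).
  have : n * (delta + q * rho) <= k%:R * (C + 1) * (delta + q * rho).
    by rewrite ler_wpM2r //; lra.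
  have -> : k%:R * (C + 1) * (delta + q * rho) = (C + 1) * s by rewrite sk; ring.
  lra.
(* The two unit losses add 2 t = delta / 2 to the exponent, within the allowed delta. *)
have : delta / 4 * (n * delta - 2) <= delta / 4 * (C * s - n * (q * rho) - p * (1 - rho)).
  by rewrite ler_wpM2l //; lra.
move: card_le; lra.
Qed.

Lemma happy_prob : balanced c -> 0 < delta -> (1 < k)%N ->
  1 - #|T|%:R * expR (delta - delta ^+ 2 / 8 * #|T|%:R) <=
  sbm_prob c p q (fun G => happy G rho c) <= 1.
Proof.
move=> bal d0 k1.
have split_prob : sbm_prob c p q (fun G => happy G rho c) +
    sbm_prob c p q (fun G => ~~ happy G rho c) = 1.
  by rewrite -(sbm_probT c p q) /sbm_prob [RHS](bigID (fun G => happy G rho c)).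
have m0 G : 0 <= sbm_mass c p q G by exact: sbm_mass_ge0.
have N0 : 0 <= sbm_prob c p q (fun G => ~~ happy G rho c) by exact: sumr_ge0.
suff : sbm_prob c p q (fun G => ~~ happy G rho c) <=
    #|T|%:R * expR (delta - delta ^+ 2 / 8 * #|T|%:R).
  by move=> ?; apply/andP; split; lra.
rewrite mulr_natl -[#|T|]/#|xpredT| -sumr_const.
apply: (@le_trans _ _ (\sum_v sbm_prob c p q [pred G | ~~ happy_vertex G rho c v])).
  (* Union bound: after exchanging the sums, the mass of a graph that is not happy is counted once
     for each unhappy vertex, so at least once. *)
  rewrite /sbm_prob [leRHS](exchange_big_dep predT) //= big_mkcond; apply: ler_sum => G _.
  case: ifPn => [|_]; last exact: sumr_ge0.
  rewrite negb_forall => /existsP[v vG].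
  by rewrite (bigD1 v) //= lerDl sumr_ge0.
by apply: ler_sum => v _; exact: unhappy_vertex_prob.
Qed.

End Chernoff.

Local Open Scope classical_set_scope.
Local Open Scope ring_scope.

Lemma cvg_linear_expR {R : realType} (a b : R) : 0 < a ->
  n%:R * expR (b - a * n%:R) @[n --> \oo] --> (0 : R).
Proof.
(* Squaring exp(a n / 2) >= a n / 2 gives n^2 exp(- a n) <= 4 / a^2; the further factor 2 in 8 comes
   from n (n + 1) <= 2 n^2, as [harmonic n] is 1 / (n + 1). *)
move=> a0; pose K := expR b * (8 / a ^+ 2).
apply: (@squeeze_cvgr _ _ _ _ (fun=> 0) (fun n => K * harmonic n)); last 2 first.
- exact: cvg_cst.
- by rewrite -[X in _ --> X](mulr0 K); apply: cvgMl_tmp; exact: cvg_harmonic.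
apply: nearW => n; rewrite mulr_ge0 ?expR_ge0 //= ler_pdivlMr ?ltr0n //.
have sq_le : (a * n%:R / 2) ^+ 2 <= expR (a * n%:R).
  have an0 : 0 <= a * n%:R / 2 by rewrite !mulr_ge0 // ltW.
  rewrite {2}(_ : a * n%:R = a * n%:R / 2 * 2%:R); last by field.
  rewrite expRM_natr lerXn2r ?nnegrE ?expR_ge0 //.
  by apply: le_trans (expR_ge1Dx _); lra.
have nn : n%:R * n.+1%:R <= 2 * n%:R ^+ 2 :> R.
  by rewrite -natrX -!natrM ler_nat; nia.
rewrite expRB /K -!mulrA [n%:R * _]mulrCA ler_wpM2l ?expR_ge0 //.
rewrite mulrCA mulrC ler_pdivrMr ?expR_gt0 // mulrAC ler_pdivlMr ?exprn_gt0 //.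
by have := sqr_ge0 a; nra.
Qed.

Theorem theorem3 (R : realType) (p q : R) (k : nat)
    (q_gt0 : 0 < q) (q_lt_p : q < p) (p_lt1 : p < 1) (k_gt1 : (1 < k)%N)
    (rho : R) (rho_ge0 : 0 <= rho) (rho_lt : rho < xi_tilde k p q)
    (c : forall n : nat, 'I_n -> 'I_k) (c_balanced : forall n, balanced (c n)) :
  (fun n : nat => sbm_prob (c n) p q (fun G => happy G rho (c n))) @ \oo
    --> (1 : R).
Proof.
have k2 : 2 <= k%:R :> R by rewrite ler_nat.
have k0 : 0 < k%:R :> R by lra.
have D0 : 0 < p + (k%:R - 1) * q by nra.
have /andP[_ rho_lt'] : (rho < ln ((p * expR 1 + (k%:R - 1) * q) / (p + (k%:R - 1) * q)))
    && (rho < p / (p + (k%:R - 1) * q)) by rewrite -lt_min.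
move: rho_lt'; rewrite ltr_pdivlMr // => rho_lt'.
have rho1 : rho <= 1 by nra.
pose delta : R := (p * (1 - rho) - (k%:R - 1) * q * rho) / k%:R.
(* Positivity of the numerator is [rho_lt'], that is rho (p + (k - 1) q) < p, rearranged. *)
have delta0 : 0 < delta by rewrite divr_gt0 //; nra.
pose f n : R := n%:R * expR (delta - delta ^+ 2 / 8 * n%:R).
apply: (@squeeze_cvgr _ _ _ _ (fun n => 1 - f n) (fun=> 1)).
- apply: nearW => n; rewrite /f -[n in n%:R]card_ord.
  by apply: happy_prob => //; apply/andP; split; lra.
- rewrite -[X in _ --> X]subr0; apply: cvgB; first exact: cvg_cst.
  by apply: cvg_linear_expR; rewrite divr_gt0 // exprn_gt0.
- exact: cvg_cst.
Qed.
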